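(* Let $g:\subseteq\mathbb{N}^\mathbb{N}\rightrightarrows\mathbb{N}^\mathbb{N}$ be a problem which is computably true. Then the $\le_W$-minimum of $\{f: g\le_W f \text{ and } f \text{ is first-order}\}$ exists, and it is (the Weihrauch degree of) the problem $g^{\mathsf{G}}$ with $\mathrm{dom}(g^{\mathsf G})=\mathrm{dom}(g)$ defined by $g^{\mathsf G}(p)=\{e\in\mathbb{N}:\Phi_e(p)\in g(p)\}$.
   Context: $(\Phi_e)_{e\in\mathbb{N}}$ is a standard enumeration of Turing functionals. A problem $g$ is computably true if for every instance $p$ there is a solution $q\in g(p)$ with $q\le_T p$. $\le_W$: Weihrauch reducibility. $\mathrm{FOP}(f)$ is the $\le_W$-maximum of problems with codomain $\mathbb{N}$ Weihrauch reducible to $f$; $f$ is first-order if $f\equiv_W\mathrm{FOP}(f)$. *)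

(* Defs.v *)
From Stdlib Require Import Arith Cantor.

Definition baire : Type := nat -> nat.

(** Programs for the partial recursive functions relative to an oracle, in
    the presentation with unary functions and a pairing function
    [Cantor.to_nat : nat * nat -> nat] (a bijection with inverse
    [Cantor.of_nat]). *)
Inductive code : Type :=
| Zero : code
| Succ : code
| Left : code
| Right : code
| Oracle : code
| Pair : code -> code -> code
| Comp : code -> code -> code
| Prec : code -> code -> code
| Mu : code -> code.

(** Partial functions are represented by their graphs.  [prec_graph f g a]
    is the graph of [h] with [h 0 = f a] and [h (S n) = g <a, <n, h n>>]. *)
Fixpoint prec_graph (f g : nat -> nat -> Prop) (a n y : nat) : Prop :=
  match n with
  | 0 => f a y
  | S m => exists z, prec_graph f g a m z /\ g (to_nat (a, to_nat (m, z))) y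
  end.

(** [eval p c x y]: the program [c] with oracle [p] halts on input [x] with
    output [y]. *)
Fixpoint eval (p : baire) (c : code) (x y : nat) : Prop :=
  match c with
  | Zero => y = 0
  | Succ => y = S x
  | Left => y = fst (of_nat x)
  | Right => y = snd (of_nat x)
  | Oracle => y = p x
  | Pair c d => exists u v, eval p c x u /\ eval p d x v /\ y = to_nat (u, v)
  | Comp c d => exists z, eval p d x z /\ eval p c z y
  | Prec c d =>
      prec_graph (eval p c) (eval p d) (fst (of_nat x)) (snd (of_nat x)) y
  | Mu c =>
      eval p c (to_nat (x, y)) 0 /\
      forall k, k < y -> exists v, eval p c (to_nat (x, k)) (S v)
  end.

Fixpoint encode (c : code) : nat :=
  match c with
  | Zero => to_nat (0, 0)
  | Succ => to_nat (1, 0)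
  | Left => to_nat (2, 0)
  | Right => to_nat (3, 0)
  | Oracle => to_nat (4, 0)
  | Pair c d => to_nat (5, to_nat (encode c, encode d))
  | Comp c d => to_nat (6, to_nat (encode c, encode d))
  | Prec c d => to_nat (7, to_nat (encode c, encode d))
  | Mu c => to_nat (8, encode c)
  end.

(** [Phi e p q]: the partial functional [Phi_e] on Baire space is defined at
    [p] with value [q].  Numbers that are not codes of programs index the
    nowhere defined functional. *)
Definition Phi (e : nat) (p q : baire) : Prop :=
  exists c, encode c = e /\ forall n, eval p c n (q n).

Definition turing_le (q p : baire) : Prop := exists e, Phi e p q.

Definition join (p q : baire) : baire :=
  fun n => if Nat.even n then p (Nat.div2 n) else q (Nat.div2 n).

(** [name p x] is the graph of a partial surjection from Baire space. *)
Record rspace : Type := Rspace {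
  point :> Type;
  name : baire -> point -> Prop;
  name_functional : forall p x y, name p x -> name p y -> x = y;
  name_surjective : forall x, exists p, name p x }.

Arguments name {r}.

Program Definition baire_space : rspace :=
  {| point := baire; name := fun p x => p = x |}.
Next Obligation. now exists x. Qed.

Program Definition nat_space : rspace :=
  {| point := nat; name := fun p n => p 0 = n |}.
Next Obligation. now exists (fun _ => x). Qed.

(** Partial multivalued functions; [f x y] reads "y is a solution of x". *)
Definition problem (X Y : rspace) : Type := X -> Y -> Prop.

Definition dom {X Y : rspace} (f : problem X Y) (x : X) : Prop :=
  exists y, f x y.

Definition weihrauch_le {X Y X' Y' : rspace}
    (f : problem X Y) (g : problem X' Y') : Prop :=
  exists h k : nat,
    forall (p : baire) (x : X), name p x -> dom f x ->
    exists (p' : baire) (x' : X'),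
      Phi h p p' /\ name p' x' /\ dom g x' /\
      forall (q' : baire) (y' : Y'), name q' y' -> g x' y' ->
      exists (q : baire) (y : Y),
        Phi k (join p q') q /\ name q y /\ f x y.

Definition weihrauch_equiv {X Y X' Y' : rspace}
    (f : problem X Y) (g : problem X' Y') : Prop :=
  weihrauch_le f g /\ weihrauch_le g f.

Definition problem_class : Type := forall X Y : rspace, problem X Y -> Prop.

Definition is_weihrauch_min (C : problem_class)
    {X Y : rspace} (h : problem X Y) : Prop :=
  C X Y h /\
  forall (X' Y' : rspace) (f : problem X' Y'), C X' Y' f -> weihrauch_le h f.

(** FOP(f) is determined only up to Weihrauch equivalence, so it is rendered
    as the predicate "[h] is a representative of FOP(f)". *)
Definition is_FOP {X Y Z : rspace}
    (f : problem X Y) (h : problem Z nat_space) : Prop :=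
  weihrauch_le h f /\
  forall (W : rspace) (k : problem W nat_space),
    weihrauch_le k f -> weihrauch_le k h.

Definition first_order {X Y : rspace} (f : problem X Y) : Prop :=
  exists (Z : rspace) (h : problem Z nat_space),
    is_FOP f h /\ weihrauch_equiv f h.

Definition computably_true (g : problem baire_space baire_space) : Prop :=
  forall p, dom g p -> exists q, g p q /\ turing_le q p.

Definition first_order_above {X Y : rspace} (g : problem X Y) : problem_class :=
  fun _ _ f => weihrauch_le g f /\ first_order f.

(** g^G; a code [e] is a solution of [p] iff Phi_e(p) is in g(p). *)
Definition index_problem (g : problem baire_space baire_space) :
    problem baire_space nat_space :=
  fun p e => exists q, Phi e p q /\ g p q.

(* Main.v *)
(** The problem [g] reduces to [index_problem g] because there is a universal
    oracle program: it runs a stack machine whose states are coded by numbers.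
    Conversely, suppose that [g] reduces to a problem [h] with codomain [nat].
    A solution [n] of the instance of [h] built from [p] determines a solution
    of [p] computable from [p] and [n]; an index of it relative to [p] alone is
    computed from [n] by hard-coding the constant [n] (the s-m-n theorem), so
    [index_problem g] reduces to [h] as well. *)

From Stdlib Require Import Arith Cantor Lia List Classical.
Require Import Defs.
Import ListNotations.

Local Notation pr x y := (to_nat (x, y)).
Local Notation lft x := (fst (of_nat x)).
Local Notation rgt x := (snd (of_nat x)).

Local Opaque to_nat of_nat.

Lemma pr_lft_rgt (x : nat) : pr (lft x) (rgt x) = x.
Proof. rewrite <- surjective_pairing. apply cancel_to_of. Qed.

Lemma of_nat_0 : of_nat 0 = (0, 0).
Proof. reflexivity. Qed.

Lemma pr_inj (a b c d : nat) : pr a b = pr c d -> a = c /\ b = d.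
Proof. intros H%to_nat_inj. now injection H. Qed.

Ltac simpl_pairs := repeat (progress (cbn; rewrite ?cancel_of_to)).

(** * Uniformly computable functions *)

(** A sigma type in [Set], not an existential, so that [code_of] can extract the program and build
    it into larger ones. *)
Definition uniform (F : baire -> nat -> nat) : Set :=
  {c : code | forall p x, eval p c x (F p x)}.

Definition code_of {F : baire -> nat -> nat} (u : uniform F) : code := proj1_sig u.

Lemma uniform_id : uniform (fun p x => x).
Proof.
  exists (Pair Left Right). intros p x. exists (lft x), (rgt x).
  now rewrite pr_lft_rgt.
Qed.

Lemma uniform_comp (F G : baire -> nat -> nat) :
  uniform F -> uniform G -> uniform (fun p x => F p (G p x)).
Proof.
  intros [c Hc] [d Hd]. exists (Comp c d). intros p x. now exists (G p x).
Qed.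

Lemma uniform_S (F : baire -> nat -> nat) :
  uniform F -> uniform (fun p x => S (F p x)).
Proof. apply (uniform_comp (fun _ y => S y)). now exists Succ. Qed.

Lemma uniform_lft (F : baire -> nat -> nat) :
  uniform F -> uniform (fun p x => lft (F p x)).
Proof. apply (uniform_comp (fun _ y => lft y)). now exists Left. Qed.

Lemma uniform_rgt (F : baire -> nat -> nat) :
  uniform F -> uniform (fun p x => rgt (F p x)).
Proof. apply (uniform_comp (fun _ y => rgt y)). now exists Right. Qed.

Lemma uniform_oracle (F : baire -> nat -> nat) :
  uniform F -> uniform (fun p x => p (F p x)).
Proof. apply (uniform_comp (fun p y => p y)). now exists Oracle. Qed.

Lemma uniform_pr (F G : baire -> nat -> nat) :
  uniform F -> uniform G -> uniform (fun p x => pr (F p x) (G p x)).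
Proof.
  intros [c Hc] [d Hd]. exists (Pair c d). intros p x.
  now exists (F p x), (G p x).
Qed.

Fixpoint const_code (n : nat) : code :=
  match n with
  | 0 => Zero
  | S m => Comp Succ (const_code m)
  end.

Lemma eval_const_code (p : baire) (n x : nat) : eval p (const_code n) x n.
Proof. induction n as [|n IH]; [easy|]. now exists n. Qed.

Lemma uniform_const (n : nat) : uniform (fun p x => n).
Proof. exists (const_code n). intros. apply eval_const_code. Qed.

Lemma uniform_iter (N F : baire -> nat -> nat) (G : baire -> nat -> nat -> nat) :
  uniform N -> uniform F -> uniform (fun p s => G p (lft s) (rgt s)) ->
  uniform (fun p x => Nat.iter (N p x) (G p x) (F p x)).
Proof.
  intros UN [c Hc] [d Hd].
  assert (U : uniform (fun p s => Nat.iter (rgt s) (G p (lft s)) (F p (lft s)))).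
  (* [Prec] passes the triple of parameter, counter and value to its step program; the composition
     with [Pair Left (Comp Right Right)] drops the counter. *)
  { exists (Prec c (Comp d (Pair Left (Comp Right Right)))). intros p s. cbn.
    induction (rgt s) as [|n IH]; [apply Hc|].
    eexists. split; [exact IH|].
    set (z := Nat.iter n _ _). exists (pr (lft s) z). split.
    - exists (lft s), z. simpl_pairs. repeat split.
      exists (pr n z). now simpl_pairs.
    - specialize (Hd p (pr (lft s) z)). simpl_pairs. now rewrite cancel_of_to in Hd. }
  destruct (uniform_comp _ _ U (uniform_pr _ _ uniform_id UN)) as [e He].
  exists e. intros p x. specialize (He p x). now rewrite cancel_of_to in He.
Qed.

(** Written with [Nat.iter], the one recursor that [uniform_iter] handles. *)
Definition ifz (n a b : nat) : nat := Nat.iter n (fun _ => b) a.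

Lemma uniform_ifz (N F G : baire -> nat -> nat) :
  uniform N -> uniform F -> uniform G ->
  uniform (fun p x => ifz (N p x) (F p x) (G p x)).
Proof.
  intros UN UF UG. apply (uniform_iter N F (fun p x _ => G p x)); trivial.
  apply (uniform_comp G); trivial. apply uniform_lft, uniform_id.
Qed.

Lemma uniform_ext (F G : baire -> nat -> nat) :
  (forall p x, F p x = G p x) -> uniform F -> uniform G.
Proof. intros E [c Hc]. exists c. intros. now rewrite <- E. Qed.

Ltac uniform_step :=
  first
    [ apply uniform_const
    | apply uniform_id
    | apply uniform_S
    | apply uniform_pr
    | apply uniform_lft
    | apply uniform_rgt
    | apply uniform_ifz
    | apply uniform_oracle ].

(** An iteration does not see its counter, so it carries the pair of [pred y] and [y]. *)
Lemma uniform_pred (F : baire -> nat -> nat) :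
  uniform F -> uniform (fun p x => pred (F p x)).
Proof.
  apply (uniform_comp (fun _ y => pred y)).
  apply (uniform_ext
    (fun _ y => lft (Nat.iter y (fun z => pr (rgt z) (S (rgt z))) (pr 0 0)))).
  - intros _ y.
    enough (E : Nat.iter y (fun z => pr (rgt z) (S (rgt z))) (pr 0 0)
                = pr (pred y) y) by (rewrite E; now simpl_pairs).
    induction y as [|y IH]; [easy|].
    rewrite Nat.iter_succ, IH. now simpl_pairs.
  - apply uniform_lft.
    apply (uniform_iter (fun _ y => y) _ (fun _ _ z => pr (rgt z) (S (rgt z))));
      repeat uniform_step.
Qed.

Lemma uniform_double : uniform (fun p x => 2 * x).
Proof.
  apply (uniform_ext (fun _ x => Nat.iter x (fun z => S (S z)) 0)).
  - intros _ x. induction x as [|x IH]; [easy|].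
    rewrite Nat.iter_succ, IH. lia.
  - apply (uniform_iter (fun _ x => x) _ (fun _ _ z => S (S z)));
      repeat uniform_step.
Qed.

(** The iteration computes the pair of the halves of [x] and [S x]. *)
Lemma uniform_div2 : uniform (fun p x => Nat.div2 x).
Proof.
  apply (uniform_ext
    (fun _ x => lft (Nat.iter x (fun z => pr (rgt z) (S (lft z))) (pr 0 0)))).
  - intros _ x.
    enough (E : Nat.iter x (fun z => pr (rgt z) (S (lft z))) (pr 0 0)
                = pr (Nat.div2 x) (Nat.div2 (S x))) by (rewrite E; now simpl_pairs).
    induction x as [|x IH]; [easy|].
    rewrite Nat.iter_succ, IH. now simpl_pairs.
  - apply uniform_lft.
    apply (uniform_iter (fun _ x => x) _ (fun _ _ z => pr (rgt z) (S (lft z))));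
      repeat uniform_step.
Qed.

Lemma uniform_parity : uniform (fun p x => if Nat.even x then 0 else 1).
Proof.
  apply (uniform_ext (fun _ x => Nat.iter x (fun z => ifz z 1 0) 0)).
  - intros _ x. induction x as [|x IH]; [easy|].
    rewrite Nat.iter_succ, IH, Nat.even_succ, <- Nat.negb_even.
    now destruct (Nat.even x).
  - apply (uniform_iter (fun _ x => x) _ (fun _ _ z => ifz z 1 0));
      repeat uniform_step.
Qed.

(** * Substitution of a program for the oracle *)

Definition computes (c : code) (p q : baire) : Prop := forall n, eval p c n (q n).

Fixpoint subst (c d : code) : code :=
  match c with
  | Oracle => d
  | Pair a b => Pair (subst a d) (subst b d)
  | Comp a b => Comp (subst a d) (subst b d)
  | Prec a b => Prec (subst a d) (subst b d)
  | Mu a => Mu (subst a d)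
  | _ => c
  end.

Lemma prec_graph_mono (f g f' g' : nat -> nat -> Prop) :
  (forall x y, f x y -> f' x y) -> (forall x y, g x y -> g' x y) ->
  forall a n y, prec_graph f g a n y -> prec_graph f' g' a n y.
Proof.
  intros Hf Hg a n. induction n as [|n IH]; cbn; [auto|].
  intros y (z & Hz & Hy). exists z. auto.
Qed.

(** Induction on [c] works because [eval] is monotone in the graphs of the subprograms: even [Mu]
    asks positively that earlier values be successors. *)
Lemma eval_subst (d : code) (p q : baire) :
  computes d p q -> forall c x y, eval q c x y -> eval p (subst c d) x y.
Proof.
  intros Hd c.
  induction c as [| | | | |a IHa b IHb|a IHa b IHb|a IHa b IHb|a IHa]; cbn; auto.
  - intros x y ->. apply Hd.
  - intros x y (u & v & Hu & Hv & ->). exists u, v. auto.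
  - intros x y (z & Hz & Hy). exists z. auto.
  - intros x y. apply prec_graph_mono; auto.
  - intros x y [H0 HS]. split; [auto|]. intros k Hk.
    destruct (HS k Hk) as [v Hv]. exists v. auto.
Qed.

Lemma computes_subst (c d : code) (p q r : baire) :
  computes d p q -> computes c q r -> computes (subst c d) p r.
Proof. intros Hd Hc n. now apply (eval_subst d p q). Qed.

Lemma uniform_select :
  uniform (fun p s => ifz (if Nat.even (lft s) then 0 else 1)
                          (lft (rgt s)) (rgt (rgt s))).
Proof.
  apply uniform_ifz.
  - apply (uniform_comp _ _ uniform_parity). repeat uniform_step.
  - repeat uniform_step.
  - repeat uniform_step.
Qed.

(** Both programs are run at every position and one value is then selected; this halts because both
    compute total sequences. *)
Definition join_code (c d : code) : code :=
  Comp (code_of uniform_select)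
    (Pair (code_of uniform_id)
       (Pair (Comp c (code_of uniform_div2)) (Comp d (code_of uniform_div2)))).

Lemma computes_join (c d : code) (o p q : baire) :
  computes c o p -> computes d o q -> computes (join_code c d) o (join p q).
Proof.
  intros Hc Hd n. pose (h := Nat.div2 n).
  exists (pr n (pr (p h) (q h))). split.
  - exists n, (pr (p h) (q h)). repeat split; [apply (proj2_sig uniform_id)|].
    exists (p h), (q h).
    repeat split; exists h; split;
      solve [apply (proj2_sig uniform_div2) | apply Hc | apply Hd].
  - generalize (proj2_sig uniform_select o (pr n (pr (p h) (q h)))).
    simpl_pairs. unfold join. fold h. now destruct (Nat.even n).
Qed.

Lemma join_double (p q : baire) (n : nat) : join p q (2 * n) = p n.
Proof. unfold join. now rewrite Nat.even_even, Nat.div2_double. Qed.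

Lemma join_S_double (p q : baire) (n : nat) : join p q (S (2 * n)) = q n.
Proof.
  unfold join. now rewrite <- Nat.add_1_r, Nat.even_odd, Nat.add_1_r, Nat.div2_succ_double.
Qed.

Lemma uniform_evens : uniform (fun o x => o (2 * x)).
Proof. apply uniform_oracle, uniform_double. Qed.

Lemma uniform_odds : uniform (fun o x => o (S (2 * x))).
Proof. apply uniform_oracle, uniform_S, uniform_double. Qed.

Lemma computes_evens (p q : baire) :
  computes (code_of uniform_evens) (join p q) p.
Proof.
  intros n. generalize (proj2_sig uniform_evens (join p q) n).
  cbv beta. now rewrite join_double.
Qed.

Lemma computes_odds (p q : baire) :
  computes (code_of uniform_odds) (join p q) q.
Proof.
  intros n. generalize (proj2_sig uniform_odds (join p q) n).
  cbv beta. now rewrite join_S_double.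
Qed.

(** * Weihrauch reductions by programs *)

Lemma encode_inj (c d : code) : encode c = encode d -> c = d.
Proof.
  revert d.
  induction c as [| | | | |a IHa b IHb|a IHa b IHb|a IHa b IHb|a IHa];
    intros [| | | | |a' b'|a' b'|a' b'|a'] [Ht H]%pr_inj;
    try discriminate Ht; try reflexivity;
    try (apply pr_inj in H as [Ha Hb]; now rewrite (IHa _ Ha), (IHb _ Hb)).
  now rewrite (IHa _ H).
Qed.

(** For an [e] that is not an index the conclusion is vacuous. *)
Lemma Phi_computes (e : nat) :
  exists c, forall p q, Phi e p q -> computes c p q.
Proof.
  destruct (classic (exists c, encode c = e)) as [[c <-]|H].
  - exists c. intros p q (c' & E & Hc'). now apply encode_inj in E as ->.
  - exists Zero. intros p q (c & E & _). destruct H. now exists c.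
Qed.

Lemma computes_Phi (c : code) (p q : baire) :
  computes c p q -> Phi (encode c) p q.
Proof. intros H. now exists c. Qed.

(** A number indexes at most one program, so indices can be traded for programs, which compose by
    [subst]. *)
Lemma weihrauch_le_code {X Y X' Y' : rspace}
    (f : problem X Y) (g : problem X' Y') :
  weihrauch_le f g <->
  exists c d : code,
    forall (p : baire) (x : X), name p x -> dom f x ->
    exists (p' : baire) (x' : X'),
      computes c p p' /\ name p' x' /\ dom g x' /\
      forall (q' : baire) (y' : Y'), name q' y' -> g x' y' ->
      exists (q : baire) (y : Y),
        computes d (join p q') q /\ name q y /\ f x y.
Proof.
  split.
  - intros (h & k & H).
    destruct (Phi_computes h) as [c Hc], (Phi_computes k) as [d Hd].
    exists c, d. intros p x Hp Hx.
    destruct (H p x Hp Hx) as (p' & x' & Hh & Hp' & Hx' & Hk).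
    exists p', x'. repeat split; auto. intros q' y' Hq' Hy'.
    destruct (Hk q' y' Hq' Hy') as (q & y & Hq & Hy). exists q, y. auto.
  - intros (c & d & H). exists (encode c), (encode d). intros p x Hp Hx.
    destruct (H p x Hp Hx) as (p' & x' & Hh & Hp' & Hx' & Hk).
    exists p', x'. split; [now apply computes_Phi|]. repeat split; auto.
    intros q' y' Hq' Hy'.
    destruct (Hk q' y' Hq' Hy') as (q & y & Hq & Hy).
    exists q, y. split; [now apply computes_Phi|auto].
Qed.

Lemma computes_oracle (p : baire) : computes Oracle p p.
Proof. now intros n. Qed.

Lemma weihrauch_le_refl {X Y : rspace} (f : problem X Y) : weihrauch_le f f.
Proof.
  apply weihrauch_le_code. exists Oracle, (code_of uniform_odds).
  intros p x Hp Hx. exists p, x.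
  split; [apply computes_oracle|]. repeat split; trivial.
  intros q y Hq Hy. exists q, y. split; [apply computes_odds|auto].
Qed.

Lemma weihrauch_le_trans {X1 Y1 X2 Y2 X3 Y3 : rspace}
    (f1 : problem X1 Y1) (f2 : problem X2 Y2) (f3 : problem X3 Y3) :
  weihrauch_le f1 f2 -> weihrauch_le f2 f3 -> weihrauch_le f1 f3.
Proof.
  rewrite !weihrauch_le_code. intros (c1 & d1 & H1) (c2 & d2 & H2).
  exists (subst c2 c1).
  pose (E := code_of uniform_evens).
  (* From [join p1 q3], [E] recovers [p1], [c1] rebuilds [p2], [d2] turns [join p2 q3] into [q2],
     and [d1] is run on [join p1 q2]. *)
  exists (subst d1
    (join_code E (subst d2 (join_code (subst c1 E) (code_of uniform_odds))))).
  intros p1 x1 Np1 Dx1.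
  destruct (H1 p1 x1 Np1 Dx1) as (p2 & x2 & Cp2 & Np2 & Dx2 & B1).
  destruct (H2 p2 x2 Np2 Dx2) as (p3 & x3 & Cp3 & Np3 & Dx3 & B2).
  exists p3, x3. split; [now apply (computes_subst _ _ _ p2)|].
  repeat split; trivial. intros q3 y3 Nq3 Hy3.
  destruct (B2 q3 y3 Nq3 Hy3) as (q2 & y2 & Cq2 & Nq2 & Hy2).
  destruct (B1 q2 y2 Nq2 Hy2) as (q1 & y1 & Cq1 & Nq1 & Hy1).
  exists q1, y1. split; [|auto].
  apply (computes_subst _ _ _ (join p1 q2)); trivial.
  apply computes_join; [apply computes_evens|].
  apply (computes_subst _ _ _ (join p2 q3)); trivial.
  apply computes_join; [|apply computes_odds].
  apply (computes_subst _ _ _ p1); trivial. apply computes_evens.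
Qed.

(** * A universal program *)

(** A state is either [run_state e x k], about to run the program with index [e]
    on input [x], or [ret_state y k], about to return [y]; [k] is the stack of
    pending computations, with [0] (whose tag is [0]) the empty stack. *)
Definition run_state (e x k : nat) : nat := pr 0 (pr (pr e x) k).
Definition ret_state (y k : nat) : nat := pr 1 (pr y k).
Definition frame (t a k : nat) : nat := pr t (pr a k).

Fixpoint switch (n : nat) (l : list nat) (d : nat) : nat :=
  match l with
  | [] => d
  | a :: l => ifz n a (switch (pred n) l d)
  end.

(** The branches follow the tags of [encode]; [Mu], with tag [8], is the default. *)
Definition run_step (p : baire) (e x k : nat) : nat :=
  let a := rgt e in
  switch (lft e)
    [ret_state 0 k; ret_state (S x) k; ret_state (lft x) k; ret_state (rgt x) k;
     ret_state (p x) k;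
     run_state (lft a) x (frame 1 (pr (rgt a) x) k);
     run_state (rgt a) x (frame 3 (lft a) k);
     run_state (lft a) (lft x)
       (frame 4 (pr (pr (rgt a) (lft x)) (pr 0 (rgt x))) k)]
    (run_state a (pr x 0) (frame 5 (pr a (pr x 0)) k)).

(** Frames [1] and [2] belong to [Pair], [3] to [Comp], [4] to [Prec] (program,
    parameter, current step, number of remaining steps) and [5] to [Mu]. *)
Definition ret_step (y k : nat) : nat :=
  let a := lft (rgt k) in
  let k' := rgt (rgt k) in
  switch (lft k)
    [ret_state y k;
     run_state (lft a) (rgt a) (frame 2 y k');
     ret_state (pr a y) k';
     run_state a y k';
     let d := lft (lft a) in
     let u := rgt (lft a) in
     let i := lft (rgt a) in
     let r := rgt (rgt a) in
     ifz r (ret_state y k')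
       (run_state d (pr u (pr i y))
          (frame 4 (pr (pr d u) (pr (S i) (pred r))) k'))]
    (let c := lft a in
     let x := lft (rgt a) in
     let j := rgt (rgt a) in
     ifz y (ret_state j k')
       (run_state c (pr x (S j)) (frame 5 (pr c (pr x (S j))) k'))).

Definition step (p : baire) (s : nat) : nat :=
  ifz (lft s) (run_step p (lft (lft (rgt s))) (rgt (lft (rgt s))) (rgt (rgt s)))
    (ret_step (lft (rgt s)) (rgt (rgt s))).

(** The universal program has a joined oracle whose even half is the oracle of the simulated
    program, so a simulated query at [x] is a query at [2 * x]. *)
Lemma uniform_step_evens : uniform (fun o s => step (fun x => o (2 * x)) s).
Proof.
  unfold step, run_step, ret_step, run_state, ret_state, frame.
  cbv beta zeta delta [switch].
  repeat first
    [ apply (uniform_comp _ _ uniform_evens)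
    | uniform_step | apply uniform_pred ].
Qed.

Definition reaches (p : baire) (s s' : nat) : Prop :=
  exists t, Nat.iter t (step p) s = s'.

Lemma reaches_trans (p : baire) (s s' s'' : nat) :
  reaches p s s' -> reaches p s' s'' -> reaches p s s''.
Proof.
  intros [t <-] [t' <-]. exists (t' + t). apply Nat.iter_add.
Qed.

Lemma reaches_step (p : baire) (s s' : nat) :
  reaches p (step p s) s' -> reaches p s s'.
Proof. intros [t <-]. exists (S t). apply Nat.iter_succ_r. Qed.

Lemma reaches_refl (p : baire) (s : nat) : reaches p s s.
Proof. now exists 0. Qed.

Ltac machine_step :=
  apply reaches_step;
  unfold step, run_step, ret_step, run_state, ret_state, frame; simpl_pairs.

(** The stack [k] is arbitrary because subprograms run on top of pushed frames. Pointwise equality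
    of the oracles suffices and avoids function extensionality for the even half of a join. *)
Lemma eval_reaches (p o : baire) :
  (forall x, o x = p x) ->
  forall c x y k, eval p c x y ->
    reaches o (run_state (encode c) x k) (ret_state y k).
Proof.
  intros E c.
  induction c as [| | | | |c IHc d IHd|c IHc d IHd|c IHc d IHd|c IHc];
    intros x y k; cbn [eval encode].
  - intros ->. machine_step. apply reaches_refl.
  - intros ->. machine_step. apply reaches_refl.
  - intros ->. machine_step. apply reaches_refl.
  - intros ->. machine_step. apply reaches_refl.
  - intros ->. machine_step. rewrite E. apply reaches_refl.
  - intros (u & v & Hu & Hv & ->). machine_step.
    eapply reaches_trans; [apply IHc, Hu|]. machine_step.
    eapply reaches_trans; [apply IHd, Hv|]. machine_step. apply reaches_refl.
  - intros (z & Hz & Hy). machine_step.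
    eapply reaches_trans; [apply IHd, Hz|]. machine_step. now apply IHc.
  - intros H. machine_step.
    (* Invariant of the [Prec] loop: [n] rounds are done and [r] remain. The induction on [n] needs
       arbitrary [r]; the claim is the case [r = 0]. *)
    assert (L : forall a n r z,
      prec_graph (eval p c) (eval p d) a n z ->
      reaches o
        (run_state (encode c) a (frame 4 (pr (pr (encode d) a) (pr 0 (n + r))) k))
        (ret_state z (frame 4 (pr (pr (encode d) a) (pr n r)) k))).
    { intros a n. induction n as [|n IH]; intros r z; cbn [prec_graph].
      - apply IHc.
      - intros (u & Hu & Hz). rewrite Nat.add_succ_comm.
        eapply reaches_trans; [apply IH, Hu|]. machine_step. apply IHd, Hz. }
    specialize (L _ _ 0 _ H). rewrite Nat.add_0_r in L.
    eapply reaches_trans; [exact L|]. machine_step. apply reaches_refl.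
  - intros [H0 HS]. machine_step.
    (* Invariant of the [Mu] loop: the search arrives at candidate [j], since all values before [y]
       are successors. *)
    assert (L : forall j, j <= y ->
      reaches o
        (run_state (encode c) (pr x 0) (frame 5 (pr (encode c) (pr x 0)) k))
        (run_state (encode c) (pr x j) (frame 5 (pr (encode c) (pr x j)) k))).
    { induction j as [|j IH]; intros Hj; [apply reaches_refl|].
      eapply reaches_trans; [apply IH; lia|].
      destruct (HS j Hj) as [v Hv].
      eapply reaches_trans; [apply IHc, Hv|]. machine_step. apply reaches_refl. }
    eapply reaches_trans; [apply (L y), le_n|].
    eapply reaches_trans; [apply IHc, H0|]. machine_step. apply reaches_refl.
Qed.

(** Zero exactly at the halted states [ret_state y 0], so that [Mu] can search for a halting
    time. *)
Definition running (s : nat) : nat :=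
  ifz (lft s) 1 (ifz (pred (lft s)) (rgt (rgt s)) 1).

Lemma running_ret (y : nat) : running (ret_state y 0) = 0.
Proof. unfold running, ret_state. now simpl_pairs. Qed.

Lemma running_0_inv (s : nat) : running s = 0 -> s = ret_state (lft (rgt s)) 0.
Proof.
  intros H. rewrite <- (pr_lft_rgt s), <- (pr_lft_rgt (rgt s)) at 1.
  unfold ret_state. revert H. unfold running.
  destruct (lft s) as [|[|m]]; [discriminate| |discriminate].
  cbn. now intros ->.
Qed.

(** The empty stack [0] decodes to tag [0], whose branch leaves the state unchanged. *)
Lemma step_ret (o : baire) (y t : nat) :
  Nat.iter t (step o) (ret_state y 0) = ret_state y 0.
Proof.
  induction t as [|t IH]; [easy|]. rewrite Nat.iter_succ, IH.
  unfold step, ret_step, ret_state. simpl_pairs. rewrite of_nat_0. now simpl_pairs.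
Qed.

(** Provides the two clauses by which [eval] describes [Mu]. *)
Lemma least_zero (f : nat -> nat) (n : nat) :
  f n = 0 ->
  exists m, m <= n /\ f m = 0 /\ forall k, k < m -> exists v, f k = S v.
Proof.
  induction n as [n IH] using lt_wf_ind. intros Hn.
  destruct (classic (exists k, k < n /\ f k = 0)) as [(k & Hk & Hf)|H].
  - destruct (IH k Hk Hf) as (m & Hm & Hfm & Hl). exists m. split; [lia|auto].
  - exists n. repeat split; trivial. intros k Hk.
    destruct (f k) as [|v] eqn:Hf; [|now exists v].
    destruct H. now exists k.
Qed.

(** For [o = join p r] the entry [o 1] is [r 0], the index named by [r], and the even entries of [o]
    form [p]. *)
Definition trace (o : baire) (n t : nat) : nat :=
  Nat.iter t (step (fun x => o (2 * x))) (run_state (o 1) n 0).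

Lemma uniform_trace : uniform (fun o s => trace o (lft s) (rgt s)).
Proof.
  unfold trace.
  apply (uniform_iter (fun _ s => rgt s) (fun o s => run_state (o 1) (lft s) 0)
           (fun o _ z => step (fun x => o (2 * x)) z)).
  - repeat uniform_step.
  - unfold run_state. repeat uniform_step.
  - apply (uniform_comp _ _ uniform_step_evens). repeat uniform_step.
Qed.

Lemma uniform_running : uniform (fun o s => running (trace o (lft s) (rgt s))).
Proof.
  apply (uniform_comp (fun _ s => running s)).
  - unfold running. repeat first [uniform_step | apply uniform_pred].
  - exact uniform_trace.
Qed.

Definition universal_code : code :=
  Comp (code_of (uniform_lft _ (uniform_rgt _ uniform_trace)))
    (Pair (code_of uniform_id) (Mu (code_of uniform_running))).

Lemma computes_universal (p q r : baire) :
  Phi (r 0) p q -> computes universal_code (join p r) q.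
Proof.
  intros (c & Ec & Hc) n. set (o := join p r).
  assert (R : reaches (fun x => o (2 * x)) (run_state (o 1) n 0) (ret_state (q n) 0)).
  { change (o 1) with (r 0). rewrite <- Ec. apply (eval_reaches p); [|apply Hc].
    apply join_double. }
  destruct R as [T HT].
  destruct (least_zero (fun t => running (trace o n t)) T) as (t & Ht & H0 & HS); cbv beta in *.
  { unfold trace. rewrite HT. apply running_ret. }
  (* The search may stop at a time [t] before [T], but a halted state never changes, so the states
     at [t] and [T] agree. *)
  assert (E : trace o n t = ret_state (q n) 0).
  { unfold trace in *. replace T with ((T - t) + t) in HT by lia.
    rewrite Nat.iter_add, (running_0_inv _ H0), step_ret in HT.
    now rewrite (running_0_inv _ H0). }
  exists (pr n t). split.
  - exists n, t. repeat split.
    + apply (proj2_sig uniform_id).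
    + generalize (proj2_sig uniform_running o (pr n t)).
      cbv beta. rewrite cancel_of_to. cbn [fst snd]. now rewrite H0.
    + intros k Hk. destruct (HS k Hk) as [v Hv]. exists v.
      generalize (proj2_sig uniform_running o (pr n k)).
      cbv beta. rewrite cancel_of_to. cbn [fst snd]. now rewrite Hv.
  - generalize (proj2_sig (uniform_lft _ (uniform_rgt _ uniform_trace)) o (pr n t)).
    cbv beta. rewrite cancel_of_to. cbn [fst snd]. rewrite E. unfold ret_state. now simpl_pairs.
Qed.

(** * Hard-coding a parameter *)

Lemma uniform_encode_const_code : uniform (fun p n => encode (const_code n)).
Proof.
  (* [6] is the tag of [Comp] in [encode]. *)
  apply (uniform_ext (fun _ n =>
    Nat.iter n (fun z => pr 6 (pr (encode Succ) z)) (encode Zero))).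
  - intros _ n. induction n as [|n IH]; [easy|]. now rewrite Nat.iter_succ, IH.
  - apply (uniform_iter (fun _ n => n) _
             (fun _ _ z => pr 6 (pr (encode Succ) z))); repeat uniform_step.
Qed.

Lemma uniform_encode_join_code (C D : nat -> code) :
  uniform (fun p n => encode (C n)) -> uniform (fun p n => encode (D n)) ->
  uniform (fun p n => encode (join_code (C n) (D n))).
Proof.
  intros UC UD. unfold join_code. cbn [encode].
  repeat first [apply UC | apply UD | uniform_step].
Qed.

(** Since [c] is fixed, the index is a fixed finite pairing expression in constants and
    [encode (D n)]. *)
Lemma uniform_encode_subst (c : code) (D : nat -> code) :
  uniform (fun p n => encode (D n)) ->
  uniform (fun p n => encode (subst c (D n))).
Proof.
  intros UD. induction c; cbn [subst encode];
    repeat first [assumption | uniform_step].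
Qed.

(** The parameter enters through the oracle: queries are answered from the join of the true oracle
    with the constant sequence [n]. *)
Definition hardcode (c : code) (n : nat) : code :=
  subst c (join_code Oracle (const_code n)).

Lemma computes_hardcode (c : code) (n : nat) (p q : baire) :
  computes c (join p (fun _ => n)) q -> computes (hardcode c n) p q.
Proof.
  apply computes_subst, computes_join; [apply computes_oracle|].
  intros x. apply eval_const_code.
Qed.

Lemma uniform_encode_hardcode (c : code) :
  uniform (fun o x => encode (hardcode c (o 1))).
Proof.
  apply (uniform_comp (fun _ n => encode (hardcode c n)) (fun o _ => o 1)).
  - apply (uniform_encode_subst c (fun n => join_code Oracle (const_code n))).
    apply uniform_encode_join_code.
    + apply uniform_const.
    + apply uniform_encode_const_code.
  - repeat uniform_step.
Qed.

(** * Minimality of the index problem *)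

Lemma dom_index_problem (g : problem baire_space baire_space) :
  computably_true g -> forall p, dom (index_problem g) p <-> dom g p.
Proof.
  intros Hg p. split.
  - intros (e & q & _ & Hq). now exists q.
  - intros Hp. destruct (Hg p Hp) as (q & Hq & e & He). now exists e, q.
Qed.

Lemma weihrauch_le_index_problem (g : problem baire_space baire_space) :
  computably_true g -> weihrauch_le g (index_problem g).
Proof.
  intros Hg. apply weihrauch_le_code. exists Oracle, universal_code.
  intros p x -> Hx. exists x, x. split; [apply computes_oracle|].
  repeat split; [now apply dom_index_problem|].
  intros r e <- (q & Hq & Hgq). exists q, q. repeat split; trivial.
  now apply computes_universal.
Qed.

(** A problem with codomain the natural numbers represents its own first-order part. *)
Lemma first_order_nat {Z : rspace} (h : problem Z nat_space) : first_order h.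
Proof.
  exists Z, h. split; [split|split]; auto using weihrauch_le_refl.
Qed.

Lemma index_problem_weihrauch_le {Z : rspace}
    (g : problem baire_space baire_space) (h : problem Z nat_space) :
  weihrauch_le g h -> weihrauch_le (index_problem g) h.
Proof.
  rewrite !weihrauch_le_code. intros (c & d & H).
  exists c, (code_of (uniform_encode_hardcode d)).
  intros p x Hp (e & q & _ & Hq).
  destruct (H p x Hp (ex_intro _ q Hq)) as (p' & z & Hc & Hp' & Hz & Hd).
  exists p', z. repeat split; trivial. intros r n Hr Hn.
  (* The backward program must succeed on every name of [n]. The constant name is chosen, as it is
     the one that [hardcode] can build in; of the given name [r] only [r 0] is then read. *)
  destruct (Hd (fun _ => n) n eq_refl Hn) as (q1 & y & Hq1 & Hy & Hgy).
  cbn in Hp, Hr, Hy. subst x n y.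
  exists (fun _ => encode (hardcode d (r 0))), (encode (hardcode d (r 0))).
  repeat split.
  - intros x. apply (proj2_sig (uniform_encode_hardcode d) (join p r) x).
  - exists q1. split; trivial. now apply computes_Phi, computes_hardcode.
Qed.

Theorem theorem6p1 (g : problem baire_space baire_space) :
  computably_true g ->
  (forall p : baire_space, dom (index_problem g) p <-> dom g p) /\
  is_weihrauch_min (first_order_above g) (index_problem g).
Proof.
  intros Hg. split; [now apply dom_index_problem|]. split.
  - split; [now apply weihrauch_le_index_problem | apply first_order_nat].
  - intros X Y f (Hgf & Z & h & _ & Hfh & Hhf).
    (* The chain is [index_problem g] to [h] to [f], where the first reduction comes from [g]
       reducing to [f] and [f] to [h]. *)
    apply (weihrauch_le_trans _ h); trivial.
    apply index_problem_weihrauch_le. now apply (weihrauch_le_trans _ f).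
Qed.
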